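(* Work in $\mathrm{ZF}^-$. The class $HW$ of hereditarily winning sets is an inner model of $\mathrm{ZF}^-$, i.e. a transitive class containing all ordinals in which all axioms of $\mathrm{ZF}^-$ hold. Moreover, $HW\supseteq V_\infty$.
   Context: $\mathrm{ZF}^-$ denotes Zermelo–Fraenkel set theory without the Axiom of Regularity (AR) and without the Axiom of Choice. For a set $x$, consider the following two-player game: player I chooses $x_0\in x$, then player II chooses $x_1\in x_0$, then I chooses $x_2\in x_1$, and so on; a player loses if it cannot make a move (i.e. the current set is empty), and then its adversary wins. A set $x$ is winning if one of the two players has a winning strategy in the game starting from $x$; $W$ denotes the class of winning sets. $HW=\{x:\mathrm{tc}(\{x\})\subseteq W\}$ is the class of hereditarily winning sets, where $\mathrm{tc}$ is transitive closure. $V_\infty=\bigcup_{\alpha\in On}V_\alpha$ is the class of well-founded sets, where $V_0=\emptyset$, $V_{\alpha+1}=\mathcal P(V_\alpha)$, $V_\lambda=\bigcup_{\alpha<\lambda}V_\alpha$ for limit $\lambda$.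
   Formalization: Since Choice is absent, a winning strategy may keep several of its player's moves, and ''every play ends'' means its tree of positions is well-founded; with single-valued strategies HW ⊇ V_∞ can fail without Choice. Under Choice the notions agree. *)

(* Defs.v *)
Record set_structure := SetStructure {
  carrier :> Type;
  mem : carrier -> carrier -> Prop
}.
Arguments mem {s} x y.

Declare Scope set_theory_scope.
Notation "x ∈ y" := (mem x y) (at level 70, no associativity) : set_theory_scope.
Open Scope set_theory_scope.

(** ** First-order formulas of the language {∈, =}; variables are de Bruijn
    indices, [fall] binding index 0. *)

Inductive formula : Type :=
| fmem (i j : nat)
| feq (i j : nat)
| fbot
| fimp (p q : formula)
| fall (p : formula).

Definition scons {T : Type} (x : T) (e : nat -> T) (n : nat) : T :=
  match n with O => x | S k => e k end.

Fixpoint sat (M : set_structure) (e : nat -> M) (p : formula) : Prop :=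
  match p with
  | fmem i j => e i ∈ e j
  | feq i j => e i = e j
  | fbot => False
  | fimp q r => sat M e q -> sat M e r
  | fall q => forall x : M, sat M (scons x e) q
  end.

(** ** Basic set-theoretic notions, evaluated inside a structure *)

Definition subset {M : set_structure} (x y : M) : Prop :=
  forall z, z ∈ x -> z ∈ y.

Definition is_empty {M : set_structure} (x : M) : Prop :=
  forall z, ~ z ∈ x.

Definition is_pair {M : set_structure} (a b p : M) : Prop :=
  forall z, z ∈ p <-> z = a \/ z = b.

Definition is_union {M : set_structure} (x u : M) : Prop :=
  forall z, z ∈ u <-> exists y, y ∈ x /\ z ∈ y.

Definition is_powerset {M : set_structure} (x p : M) : Prop :=
  forall z, z ∈ p <-> subset z x.

(* [s] is [x ∪ {x}] *)
Definition is_succ {M : set_structure} (x s : M) : Prop :=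
  forall z, z ∈ s <-> z ∈ x \/ z = x.

(** ** The axioms of ZF without Regularity and Choice *)

(* Without Regularity, Replacement is weaker than Collection; ZF^- has
   Replacement.  The environment [e] supplies the parameters. *)
Record ZFminus (M : set_structure) : Prop := {
  zf_extensionality :
    forall x y : M, (forall z, z ∈ x <-> z ∈ y) -> x = y;
  zf_pairing :
    forall a b : M, exists p, is_pair a b p;
  zf_union :
    forall x : M, exists u, is_union x u;
  zf_powerset :
    forall x : M, exists p, is_powerset x p;
  zf_infinity :
    exists w : M,
      (exists o, is_empty o /\ o ∈ w) /\
      (forall x, x ∈ w -> exists s, is_succ x s /\ s ∈ w);
  zf_separation :
    forall (p : formula) (e : nat -> M) (x : M),
      exists y, forall z, z ∈ y <-> z ∈ x /\ sat M (scons z e) p;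
  zf_replacement :
    forall (p : formula) (e : nat -> M) (x : M),
      (forall u v v', u ∈ x ->
         sat M (scons v (scons u e)) p -> sat M (scons v' (scons u e)) p ->
         v = v') ->
      exists y, forall v,
        v ∈ y <-> exists u, u ∈ x /\ sat M (scons v (scons u e)) p
}.

(** ** Functions, ordinals, natural numbers *)

(* Kuratowski pairs *)
Definition is_opair {M : set_structure} (a b p : M) : Prop :=
  exists s d, is_pair a a s /\ is_pair a b d /\ is_pair s d p.

Definition app {M : set_structure} (f u v : M) : Prop :=
  exists p, is_opair u v p /\ p ∈ f.

Definition is_function {M : set_structure} (f d : M) : Prop :=
  (forall p, p ∈ f -> exists u v, u ∈ d /\ is_opair u v p) /\
  (forall u, u ∈ d -> exists! v, app f u v).

Definition is_transitive {M : set_structure} (x : M) : Prop :=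
  forall y z, y ∈ x -> z ∈ y -> z ∈ x.

(* Regularity being absent, the well-foundedness of ∈ on [a] is a genuine part
   of the definition. *)
Definition is_ordinal {M : set_structure} (a : M) : Prop :=
  is_transitive a /\
  (forall x, x ∈ a -> ~ x ∈ x) /\
  (forall x y z, x ∈ a -> y ∈ a -> z ∈ a -> x ∈ y -> y ∈ z -> x ∈ z) /\
  (forall x y, x ∈ a -> y ∈ a -> x ∈ y \/ x = y \/ y ∈ x) /\
  (forall s, subset s a -> (exists x, x ∈ s) ->
     exists m, m ∈ s /\ forall y, y ∈ s -> ~ y ∈ m).

Definition is_limit {M : set_structure} (a : M) : Prop :=
  is_ordinal a /\ ~ is_empty a /\ ~ (exists b, is_succ b a).

Definition is_nat {M : set_structure} (n : M) : Prop :=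
  is_ordinal n /\
  forall m, m ∈ n \/ m = n -> is_empty m \/ exists k, is_succ k m.

(* For [n] a natural number of [M]: the alternating subset [h] of [n + 1] that
   contains 0 also contains [n]. *)
Definition is_even {M : set_structure} (n : M) : Prop :=
  exists h,
    (forall o, is_empty o -> o ∈ h) /\
    (forall k s, k ∈ n -> is_succ k s -> (s ∈ h <-> ~ k ∈ h)) /\
    n ∈ h.

(** ** The cumulative hierarchy *)

(* [f] is the sequence [V_a] for [a < d]. *)
Definition is_hierarchy {M : set_structure} (f d : M) : Prop :=
  is_ordinal d /\ is_function f d /\
  forall a v, a ∈ d -> app f a v ->
    (is_empty a -> is_empty v) /\
    (forall b u, is_succ b a -> app f b u -> is_powerset u v) /\
    (is_limit a -> forall z, z ∈ v <-> exists b u, b ∈ a /\ app f b u /\ z ∈ u).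

Definition is_V {M : set_structure} (a v : M) : Prop :=
  exists f d, is_hierarchy f d /\ a ∈ d /\ app f a v.

Definition V_infty {M : set_structure} (x : M) : Prop :=
  exists a v, is_ordinal a /\ is_V a v /\ x ∈ v.

(** ** The game *)

Inductive player : Type := player_I | player_II.

(* [p] is the finite sequence [(x, x_0, ..., x_{n-1})], a function with domain
   [n + 1]: a position in the game from [x] after [n] moves. *)
Definition is_run {M : set_structure} (x p n : M) : Prop :=
  is_nat n /\
  (exists d, is_succ n d /\ is_function p d) /\
  (forall o, is_empty o -> app p o x) /\
  (forall k s u v, k ∈ n -> is_succ k s -> app p k u -> app p s v -> v ∈ u).

Definition to_move {M : set_structure} (P : player) (n : M) : Prop :=
  match P with
  | player_I => is_even n
  | player_II => ~ is_even n
  end.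

Definition next_run {M : set_structure} (x p q : M) : Prop :=
  exists n s, is_succ n s /\ is_run x p n /\ is_run x q s /\ subset p q.

(* A strategy is given by its tree [T] of positions.  As usual in the absence of
   Choice it may retain several moves of [P] at a position (a "quasi-strategy");
   with single-valued strategies, "every well-founded set is winning" would
   already imply the Axiom of Choice for well-founded families. *)
Definition is_strategy {M : set_structure} (x : M) (P : player) (T : M) : Prop :=
  (forall p, p ∈ T -> exists n, is_run x p n) /\
  (exists p o, is_empty o /\ is_run x p o /\ p ∈ T) /\
  (forall p q, q ∈ T -> next_run x p q -> p ∈ T) /\
  (forall p n, p ∈ T -> is_run x p n -> ~ to_move P n ->
     forall q, next_run x p q -> q ∈ T) /\
  (forall p n, p ∈ T -> is_run x p n -> to_move P n ->
     (exists q, next_run x p q) -> exists q, next_run x p q /\ q ∈ T).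

(* The adversary is to move whenever a play following [T] gets stuck, and plays
   following [T] do get stuck.  The latter is expressed by well-foundedness of
   [T], because the mere absence of infinite branches is too weak without
   Dependent Choice: both players could then have a winning strategy. *)
Definition is_winning_strategy {M : set_structure}
    (x : M) (P : player) (T : M) : Prop :=
  is_strategy x P T /\
  (forall p n c, p ∈ T -> is_run x p n -> app p n c -> is_empty c ->
     ~ to_move P n) /\
  (forall s, subset s T -> (exists p, p ∈ s) ->
     exists p, p ∈ s /\ forall q, q ∈ s -> ~ next_run x p q).

Definition winning {M : set_structure} (x : M) : Prop :=
  exists P T, is_winning_strategy x P T.

(** ** Hereditarily winning sets, inner models *)

Definition is_tc {M : set_structure} (x t : M) : Prop :=
  is_transitive t /\ subset x t /\
  forall s, is_transitive s -> subset x s -> subset t s.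

Definition HW {M : set_structure} (x : M) : Prop :=
  exists s t, is_pair x x s /\ is_tc s t /\ forall z, z ∈ t -> winning z.

Definition is_class (M : set_structure) (C : M -> Prop) : Prop :=
  exists (p : formula) (e : nat -> M), forall x, C x <-> sat M (scons x e) p.

(* Satisfaction in this structure is relativization to [C]. *)
Definition restrict (M : set_structure) (C : M -> Prop) : set_structure :=
  SetStructure {x : M | C x} (fun x y => proj1_sig x ∈ proj1_sig y).

Definition inner_model (M : set_structure) (C : M -> Prop) : Prop :=
  is_class M C /\
  (forall x y, C x -> y ∈ x -> C y) /\
  (forall a, is_ordinal a -> C a) /\
  ZFminus (restrict M C).

(* Main.v *)
(** A set all of whose elements are hereditarily winning is itself hereditarily
    winning; everything else follows from this by separation, replacement and
    ∈-induction.  To see it, work in a transitive set [t] and let the lost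
    positions be the least set containing every [y] whose elements all have a lost
    element.  Following a winning strategy tree by induction shows that a set with
    a strategy is lost or has a lost element.  Conversely, such a set has a winning
    strategy: always move to a lost position of least stage, keeping all such
    moves so that no choice is needed.  Thus a set whose elements are all winning
    is winning: either one of its elements is lost, or all of them have a lost
    element and the set is lost itself. *)

(* The axiom schemata speak of formulas only, so every set formed on the way needs a first-order
   description; predicates are kept in ordinary form and shown [definable] by a syntax-directed
   tactic. Without Regularity no rank function measures how fast a position is lost. A stage is
   instead an element of every family of sets closed under the operator and unions; linearity of the
   stages under inclusion yields a well-founded comparison of lost positions. The bare least fixed
   point would not suffice: a player who merely moves to lost positions may run around a membership
   cycle forever, whereas moving to ever earlier stages makes the tree well-founded. Winning does
   not mention [t], so stages taken in different transitive sets never have to be compared. Each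
   existence axiom of the inner model reduces to finding a set in [M] with all its elements in
   [HW]. *)
Require Import Defs.
From Stdlib Require Import Classical PeanoNat ProofIrrelevance.

(** * Definable predicates *)

Section Definability.
Variable M : set_structure.

Definition up (r : nat -> nat) (n : nat) : nat :=
  match n with O => O | S k => S (r k) end.

Fixpoint rename (r : nat -> nat) (p : formula) : formula :=
  match p with
  | fmem i j => fmem (r i) (r j)
  | feq i j => feq (r i) (r j)
  | fbot => fbot
  | fimp q s => fimp (rename r q) (rename r s)
  | fall q => fall (rename (up r) q)
  end.

Lemma sat_ext (p : formula) :
  forall e e' : nat -> M, (forall n, e n = e' n) -> (sat M e p <-> sat M e' p).
Proof.
  induction p as [i j|i j| |p IHp q IHq|p IHp]; simpl; intros e e' H.
  - rewrite !H; tauto.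
  - rewrite !H; tauto.
  - tauto.
  - rewrite (IHp e e' H), (IHq e e' H); tauto.
  - assert (Hx : forall x n, scons x e n = scons x e' n)
      by (intros x [|n]; simpl; auto).
    split; intros Ha x; apply (IHp _ _ (Hx x)); apply Ha.
Qed.

Lemma sat_rename (p : formula) :
  forall (r : nat -> nat) (e : nat -> M),
    sat M e (rename r p) <-> sat M (fun n => e (r n)) p.
Proof.
  induction p as [i j|i j| |p IHp q IHq|p IHp]; simpl; intros r e.
  - tauto.
  - tauto.
  - tauto.
  - rewrite IHp, IHq; tauto.
  - assert (Hx : forall x, sat M (scons x e) (rename (up r) p) <->
                           sat M (scons x (fun n => e (r n))) p).
    { intros x; rewrite IHp; apply sat_ext; intros [|n]; reflexivity. }
    split; intros Ha x; apply Hx; apply Ha.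
Qed.

Definition val (e : nat -> M) (s : nat + M) : M :=
  match s with inl i => e i | inr c => c end.

(* Definability with parameters: each variable of the formula is either a
   variable of the context or a parameter. *)
Definition definable (R : (nat -> M) -> Prop) : Prop :=
  exists (p : formula) (g : nat -> nat + M),
    forall e, R e <-> sat M (fun n => val e (g n)) p.

Definition atom (t : (nat -> M) -> M) : Prop :=
  exists s, forall e, t e = val e s.

Lemma atom_var (i : nat) : atom (fun e => e i).
Proof. exists (inl i); reflexivity. Qed.

Lemma atom_const (c : M) : atom (fun _ => c).
Proof. exists (inr c); reflexivity. Qed.

Lemma definable_equiv (R R' : (nat -> M) -> Prop) :
  (forall e, R e <-> R' e) -> definable R -> definable R'.
Proof.
  intros H (p & g & Hp); exists p, g; intros e; rewrite <- H; apply Hp.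
Qed.

Lemma definable_mem (t u : (nat -> M) -> M) :
  atom t -> atom u -> definable (fun e => t e ∈ u e).
Proof.
  intros (s & Hs) (s' & Hs').
  exists (fmem 0 1), (fun n => match n with O => s | _ => s' end).
  intros e; simpl; rewrite Hs, Hs'; tauto.
Qed.

Lemma definable_eq (t u : (nat -> M) -> M) :
  atom t -> atom u -> definable (fun e => t e = u e).
Proof.
  intros (s & Hs) (s' & Hs').
  exists (feq 0 1), (fun n => match n with O => s | _ => s' end).
  intros e; simpl; rewrite Hs, Hs'; tauto.
Qed.

Lemma definable_False : definable (fun _ => False).
Proof. exists fbot, (fun n => inl n); simpl; tauto. Qed.

Lemma definable_imp (A B : (nat -> M) -> Prop) :
  definable A -> definable B -> definable (fun e => A e -> B e).
Proof.
  intros (p & g & Hp) (q & h & Hq).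
  (* The two formulas come with unrelated assignments [g] and [h]; their variables are kept apart as
     even and odd indices. *)
  exists (fimp (rename Nat.double p) (rename (fun n => S (Nat.double n)) q)),
    (fun n => if Nat.even n then g (Nat.div2 n) else h (Nat.div2 n)).
  intros e; simpl; rewrite !sat_rename, Hp, Hq.
  assert (Heven : forall n, Nat.even (Nat.double n) = true).
  { intros n; rewrite Nat.double_twice; apply Nat.even_even. }
  assert (Hg : forall n, val e (g n) = val e
     (if Nat.even (Nat.double n) then g (Nat.div2 (Nat.double n))
      else h (Nat.div2 (Nat.double n)))).
  { intros n; rewrite Heven, Nat.double_twice, Nat.div2_double; reflexivity. }
  assert (Hh : forall n, val e (h n) = val e
     (if Nat.even (S (Nat.double n)) then g (Nat.div2 (S (Nat.double n)))
      else h (Nat.div2 (S (Nat.double n))))).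
  { intros n; rewrite Nat.even_succ, <- Nat.negb_even, Heven; cbn [negb].
    rewrite Nat.double_twice, Nat.div2_succ_double; reflexivity. }
  rewrite <- (sat_ext p _ _ Hg), <- (sat_ext q _ _ Hh); tauto.
Qed.

Lemma definable_all (R : M -> (nat -> M) -> Prop) :
  definable (fun e => R (e 0) (fun n => e (S n))) ->
  definable (fun e => forall x, R x e).
Proof.
  intros (p & g & Hp).
  (* Several indices may stand for the quantified variable, namely those with [g n = inl 0]. All of
     them become the bound index; the other indices move up by one, and their context variables down
     by one. *)
  exists (fall (rename (fun n => match g n with inl O => O | _ => S n end) p)),
    (fun n => match g n with inl (S i) => inl i | s => s end).
  intros e; simpl.
  assert (Hx : forall x, R x e <->
    sat M (scons x (fun n =>
             val e (match g n with inl (S i) => inl i | s => s end)))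
      (rename (fun n => match g n with inl O => O | _ => S n end) p)).
  { intros x; rewrite sat_rename; rewrite (Hp (scons x e)).
    apply sat_ext; intros n.
    destruct (g n) as [[|i]|c] eqn:E; simpl; rewrite ?E; reflexivity. }
  split; intros H x; apply Hx; apply H.
Qed.

Lemma definable_not (A : (nat -> M) -> Prop) :
  definable A -> definable (fun e => ~ A e).
Proof. intros H; apply definable_imp; [exact H|apply definable_False]. Qed.

Lemma definable_and (A B : (nat -> M) -> Prop) :
  definable A -> definable B -> definable (fun e => A e /\ B e).
Proof.
  intros HA HB.
  apply (definable_equiv (fun e => ~ (A e -> ~ B e))).
  - intros e; tauto.
  - apply definable_not, definable_imp; [|apply definable_not]; assumption.
Qed.

Lemma definable_or (A B : (nat -> M) -> Prop) :
  definable A -> definable B -> definable (fun e => A e \/ B e).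
Proof.
  intros HA HB.
  apply (definable_equiv (fun e => ~ A e -> B e)).
  - intros e; tauto.
  - apply definable_imp; [apply definable_not|]; assumption.
Qed.

Lemma definable_ex (R : M -> (nat -> M) -> Prop) :
  definable (fun e => R (e 0) (fun n => e (S n))) ->
  definable (fun e => exists x, R x e).
Proof.
  intros H.
  apply (definable_equiv (fun e => ~ forall x, ~ R x e)).
  - intros e; split.
    + intros H1; apply not_all_not_ex; exact H1.
    + intros (x & Hx) H1; exact (H1 x Hx).
  - apply definable_not, (definable_all (fun x e => ~ R x e)), definable_not.
    exact H.
Qed.

Lemma definable_ex_player (R : player -> (nat -> M) -> Prop) :
  definable (R player_I) -> definable (R player_II) ->
  definable (fun e => exists P, R P e).
Proof.
  intros H1 H2.
  apply (definable_equiv (fun e => R player_I e \/ R player_II e)).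
  - intros e; split.
    + intros [H|H]; eauto.
    + intros ([|] & H); auto.
  - apply definable_or; assumption.
Qed.

(** As [C] sees a single entry, the formula can be evaluated in a constant environment, so all its
    context variables may be replaced by the same one. *)
Lemma definable_subst (C : M -> Prop) (t : (nat -> M) -> M) :
  definable (fun e => C (e 0)) -> atom t -> definable (fun e => C (t e)).
Proof.
  intros (p & g & Hp) (s & Hs).
  exists p, (fun n => match g n with inl _ => s | inr c => inr c end).
  intros e; rewrite (Hp (fun _ => t e)); apply sat_ext; intros n.
  destruct (g n); simpl; auto.
Qed.

Lemma definable_class (c0 : M) (C : M -> Prop) :
  definable (fun e => C (e 0)) -> is_class M C.
Proof.
  intros (p & g & Hp).
  exists (rename (fun n => match g n with inl _ => O | inr _ => S n end) p),
    (* [c0] is a filler: only the entries that hold parameters are read. *)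
    (fun n => match g n with inl _ => c0 | inr c => c end).
  intros x; rewrite sat_rename, (Hp (fun _ => x)); apply sat_ext; intros n.
  destruct (g n) eqn:E; simpl; rewrite ?E; reflexivity.
Qed.

Lemma definable_relation (c0 : M) (R : M -> M -> Prop) :
  definable (fun e => R (e 1) (e 0)) ->
  exists p e, forall u v, R u v <-> sat M (scons v (scons u e)) p.
Proof.
  intros (p & g & Hp).
  (* The formula is evaluated in [v] followed by [u] throughout, so every context index from 1 on
     can be read as 1. *)
  exists (rename (fun n => match g n with
                           | inl O => O | inl (S _) => 1 | inr _ => S (S n)
                           end) p),
    (fun n => match g n with inl _ => c0 | inr c => c end).
  intros u v; rewrite sat_rename, (Hp (scons v (fun _ => u))).
  apply sat_ext; intros n.
  destruct (g n) as [[|i]|c] eqn:E; simpl; rewrite ?E; reflexivity.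
Qed.

Lemma atom_comp (t : (nat -> M) -> M) (f : nat -> nat) :
  atom t -> atom (fun e => t (fun n => e (f n))).
Proof.
  intros (s & Hs).
  exists (match s with inl i => inl (f i) | inr c => inr c end).
  intros e; rewrite Hs; destruct s; reflexivity.
Qed.

End Definability.

Arguments definable {M} R.
Arguments atom {M} t.

(** * Automation for definability *)

Ltac dfn_atom :=
  lazymatch goal with
  | H : atom ?t |- atom ?t => exact H
  | |- atom (fun e => e _) => apply atom_var
  | |- atom (fun e => ?t (fun n => e (@?f n))) => apply (atom_comp _ t f); dfn_atom
  | |- atom _ => first [assumption | apply atom_const]
  end.

(* Redefined below, so that a run is not unfolded at each of its occurrences. *)
Ltac dfn_run := fail.

Ltac dfn_unfold :=
  first
    [ dfn_run
    | progress unfold subset, is_empty, is_pair, is_union, is_succ, is_opair, app,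
        is_function, is_transitive, is_ordinal, is_nat, is_even, next_run,
        is_strategy, is_winning_strategy, winning, is_tc, HW ].

Ltac dfn :=
  cbv beta;
  lazymatch goal with
  | |- atom _ => dfn_atom
  | |- definable (fun e => _ ∈ _) => apply definable_mem; dfn
  | |- definable (fun e => _ = _) => apply definable_eq; dfn
  | |- definable (fun e => False) => apply definable_False
  | |- definable (fun e => ~ _) => apply definable_not; dfn
  | |- definable (fun e => _ /\ _) => apply definable_and; dfn
  | |- definable (fun e => _ \/ _) => apply definable_or; dfn
  | |- definable (fun e => _ <-> _) => unfold iff; dfn
  | |- definable (fun e => exists P : player, _) => apply definable_ex_player; dfn
  | |- definable (fun e => exists x, _) => apply definable_ex; dfn
  | |- definable (fun e => exists! x, _) => unfold unique; dfn
  | |- definable (fun e => _ -> _) =>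
      (* A quantifier over [M] is a product too; it reaches the second alternative because
         [definable_imp] fails on it. *)
      first [apply definable_imp; [dfn|dfn] | apply definable_all; dfn]
  | |- definable _ =>
      first
        [ assumption
        | match goal with
          | H : definable (fun e => ?C (e 0)) |- definable (fun e => ?C (@?t e)) =>
              apply (definable_subst _ C t H); dfn
          | H : forall a b, atom a -> atom b -> definable _ |- _ => apply H; dfn
          end
        | dfn_unfold; dfn ]
  end.

Lemma definable_to_move (M : set_structure) (P : player) (a : (nat -> M) -> M) :
  atom a -> definable (fun e => to_move P (a e)).
Proof. intros; destruct P; unfold to_move; dfn. Qed.

Lemma definable_is_run (M : set_structure) (a b c : (nat -> M) -> M) :
  atom a -> atom b -> atom c -> definable (fun e => is_run (a e) (b e) (c e)).
Proof. intros; unfold is_run; dfn. Qed.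

Ltac dfn_run ::=
  first [apply definable_to_move | apply definable_is_run].

Lemma definable_HW (M : set_structure) : definable (fun e : nat -> M => HW (e 0)).
Proof. dfn. Qed.

(** * Schemata for definable predicates, and pairs *)

Section SetTheory.
Variable M : set_structure.
Hypothesis hM : ZFminus M.

Lemma set_ext (x y : M) : (forall z, z ∈ x <-> z ∈ y) -> x = y.
Proof. apply (zf_extensionality M hM). Qed.

Lemma ex_empty : exists o : M, is_empty o.
Proof.
  destruct (zf_infinity M hM) as (w & (o & Ho & _) & _); exists o; exact Ho.
Qed.

Lemma separation (P : M -> Prop) (x : M) :
  definable (fun e => P (e 0)) -> exists y, forall z, z ∈ y <-> z ∈ x /\ P z.
Proof.
  intros HP; destruct ex_empty as (c0 & _).
  destruct (definable_class M c0 P HP) as (p & e & He).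
  destruct (zf_separation M hM p e x) as (y & Hy).
  exists y; intros z; rewrite Hy, He; tauto.
Qed.

Lemma replacement (R : M -> M -> Prop) (x : M) :
  definable (fun e => R (e 1) (e 0)) ->
  (forall u v v', u ∈ x -> R u v -> R u v' -> v = v') ->
  exists y, forall v, v ∈ y <-> exists u, u ∈ x /\ R u v.
Proof.
  intros HR HF; destruct ex_empty as (c0 & _).
  destruct (definable_relation M c0 R HR) as (p & e & He).
  destruct (zf_replacement M hM p e x) as (y & Hy).
  - intros u v v' Hu H1 H2; apply (HF u); auto; apply He; assumption.
  - exists y; intros v; rewrite Hy.
    split; intros (u & Hu & H); exists u; split; auto; apply He; assumption.
Qed.

Lemma ex_union2 (a b : M) : exists u, forall z, z ∈ u <-> z ∈ a \/ z ∈ b.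
Proof.
  destruct (zf_pairing M hM a b) as (p & Hp).
  destruct (zf_union M hM p) as (u & Hu).
  exists u; intros z; rewrite (Hu z); split.
  - intros (y & Hy & Hz); apply Hp in Hy as [-> | ->]; auto.
  - intros [H|H]; [exists a|exists b]; split; auto; apply Hp; auto.
Qed.

Lemma ex_adjoin (a b : M) : exists u, forall z, z ∈ u <-> z ∈ a \/ z = b.
Proof.
  destruct (zf_pairing M hM b b) as (s & Hs).
  destruct (ex_union2 a s) as (u & Hu).
  exists u; intros z; rewrite Hu, (Hs z); tauto.
Qed.

Lemma ex_succ (a : M) : exists s, is_succ a s.
Proof. apply ex_adjoin. Qed.

Lemma ex_opair (a b : M) : exists p, is_opair a b p.
Proof.
  destruct (zf_pairing M hM a a) as (s & Hs).
  destruct (zf_pairing M hM a b) as (d & Hd).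
  destruct (zf_pairing M hM s d) as (p & Hp).
  exists p, s, d; auto.
Qed.

Lemma is_pair_unique (a b p p' : M) : is_pair a b p -> is_pair a b p' -> p = p'.
Proof. intros H H'; apply set_ext; intros z; rewrite (H z), (H' z); tauto. Qed.

Lemma is_pair_inj (a b c d p : M) :
  is_pair a b p -> is_pair c d p -> (a = c /\ b = d) \/ (a = d /\ b = c).
Proof.
  intros H H'.
  assert (Ha : a = c \/ a = d) by (apply H', H; auto).
  assert (Hb : b = c \/ b = d) by (apply H', H; auto).
  assert (Hc : c = a \/ c = b) by (apply H, H'; auto).
  assert (Hd : d = a \/ d = b) by (apply H, H'; auto).
  destruct Ha, Hb, Hc, Hd; subst; auto.
Qed.

Lemma is_opair_inj (a b c d p : M) :
  is_opair a b p -> is_opair c d p -> a = c /\ b = d.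
Proof.
  intros (s & q & Hs & Hq & Hp) (s' & q' & Hs' & Hq' & Hp').
  destruct (is_pair_inj _ _ _ _ _ Hp Hp') as [(<- & <-)|(<- & <-)].
  - destruct (is_pair_inj _ _ _ _ _ Hs Hs') as [(<- & _)|(<- & _)];
    destruct (is_pair_inj _ _ _ _ _ Hq Hq') as [(_ & <-)|(-> & ->)]; auto.
  - destruct (is_pair_inj _ _ _ _ _ Hs Hq') as [(<- & <-)|(<- & <-)];
    destruct (is_pair_inj _ _ _ _ _ Hq Hs') as [(_ & ->)|(_ & ->)]; auto.
Qed.

Lemma is_succ_unique (a s s' : M) : is_succ a s -> is_succ a s' -> s = s'.
Proof. intros H H'; apply set_ext; intros z; rewrite (H z), (H' z); tauto. Qed.

Lemma is_empty_unique (o o' : M) : is_empty o -> is_empty o' -> o = o'.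
Proof.
  intros H H'; apply set_ext; intros z; split; intros Hz;
    [destruct (H z Hz)|destruct (H' z Hz)].
Qed.

Lemma is_succ_self (a s : M) : is_succ a s -> a ∈ s.
Proof. intros H; apply H; auto. Qed.

(** * Natural numbers *)

Lemma ordinal_irrefl (a : M) : is_ordinal a -> ~ a ∈ a.
Proof. intros (_ & H & _) Ha; exact (H a Ha Ha). Qed.

Lemma ordinal_elem (a b : M) : is_ordinal a -> b ∈ a -> is_ordinal b.
Proof.
  intros (Ht & Hi & Htr & Hl & Hw) Hb.
  assert (Hsub : forall x, x ∈ b -> x ∈ a) by (intros x Hx; exact (Ht b x Hb Hx)).
  split; [|split; [|split; [|split]]].
  - intros y z Hy Hz; apply (Htr z y b); auto; apply (Ht y z); auto.
  - auto.
  - intros x y z Hx Hy Hz; apply Htr; auto.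
  - auto.
  - intros s Hs; apply Hw; intros z Hz; auto.
Qed.

Lemma ordinal_succ (a s : M) : is_ordinal a -> is_succ a s -> is_ordinal s.
Proof.
  intros Ha Hs; pose proof (ordinal_irrefl a Ha) as Hn.
  destruct Ha as (Ht & Hi & Htr & Hl & Hw).
  assert (Hna : forall y, y ∈ a -> ~ a ∈ y)
    by (intros y Hy H; exact (Hn (Ht y a Hy H))).
  split; [|split; [|split; [|split]]].
  - intros y z Hy Hz; apply Hs in Hy as [Hy | ->]; apply Hs; left; eauto.
  - intros x Hx; apply Hs in Hx as [Hx | ->]; auto.
  - intros x y z Hx Hy Hz Hxy Hyz.
    apply Hs in Hx; apply Hs in Hy; apply Hs in Hz.
    destruct Hz as [Hz | ->]; [|eauto].
    destruct Hy as [Hy | ->]; [|destruct (Hna z Hz Hyz)].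
    destruct Hx as [Hx | ->]; [eauto|destruct (Hna y Hy Hxy)].
  - intros x y Hx Hy; apply Hs in Hx; apply Hs in Hy.
    destruct Hx as [Hx | ->], Hy as [Hy | ->]; auto.
  - intros u Hu (x & Hx).
    (* A minimal element of the intersection of [u] and [a] is minimal in [u] because [a] is
       transitive; if the intersection is empty, [u] is the singleton of [a]. *)
    destruct (separation (fun z => z ∈ a) u) as (v & Hv); [dfn|].
    destruct (classic (exists z, z ∈ v)) as [Hne|He].
    + destruct (Hw v) as (m & Hm & Hmin); [|exact Hne|].
      * intros z Hz; apply Hv in Hz; tauto.
      * apply Hv in Hm as (Hm & Hma); exists m; split; auto.
        intros y Hy Hym; apply (Hmin y); auto; apply Hv; split; auto.
        exact (Ht m y Hma Hym).
    + assert (Ho : forall z, z ∈ u -> z = a).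
      { intros z Hz; destruct (proj1 (Hs z) (Hu z Hz)) as [Hza|]; auto.
        destruct He; exists z; apply Hv; auto. }
      exists x; split; auto; intros y Hy; rewrite (Ho y Hy), (Ho x Hx); auto.
Qed.

Lemma nat_irrefl (n : M) : is_nat n -> ~ n ∈ n.
Proof. intros (H & _); exact (ordinal_irrefl n H). Qed.

Lemma nat_trans (n k j : M) : is_nat n -> k ∈ n -> j ∈ k -> j ∈ n.
Proof. intros ((H & _) & _); apply H. Qed.

Lemma nat_elem (n k : M) : is_nat n -> k ∈ n -> is_nat k.
Proof.
  intros Hn Hk; split.
  - exact (ordinal_elem n k (proj1 Hn) Hk).
  - intros m [Hm | ->]; apply (proj2 Hn); left; auto.
    exact (nat_trans n k m Hn Hk Hm).
Qed.

Lemma nat_zero (o : M) : is_empty o -> is_nat o.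
Proof.
  intros Ho; split.
  - split; [|split; [|split; [|split]]].
    + intros y z Hy; destruct (Ho y Hy).
    + intros x Hx; destruct (Ho x Hx).
    + intros x y z Hx; destruct (Ho x Hx).
    + intros x y Hx; destruct (Ho x Hx).
    + intros s Hs (x & Hx); destruct (Ho x (Hs x Hx)).
  - intros m [Hm | ->]; [destruct (Ho m Hm)|auto].
Qed.

Lemma nat_succ (n s : M) : is_nat n -> is_succ n s -> is_nat s.
Proof.
  intros Hn Hs; split.
  - exact (ordinal_succ n s (proj1 Hn) Hs).
  - intros m [Hm | ->]; [|eauto]; apply (proj2 Hn), Hs, Hm.
Qed.

(** Otherwise [a] and [b] would be elements of each other, which Regularity is not there to forbid;
    transitivity of the natural number [a] would then give [a ∈ a]. *)
Lemma is_succ_inj (a b s : M) : is_nat a -> is_succ a s -> is_succ b s -> a = b.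
Proof.
  intros Ha Hs Hs'.
  destruct (proj1 (Hs' a) (is_succ_self a s Hs)) as [H|]; auto.
  destruct (proj1 (Hs b) (is_succ_self b s Hs')) as [H'|]; auto.
  destruct (nat_irrefl a Ha (nat_trans a b a Ha H' H)).
Qed.

(** The step is asked for below [n] only, since runs and alternating sets are controlled only up to
    their length. *)
Lemma nat_induction (P : M -> Prop) (n : M) :
  definable (fun e => P (e 0)) -> is_nat n ->
  (forall o, is_empty o -> P o) ->
  (forall k s, k ∈ n -> is_succ k s -> P k -> P s) ->
  P n.
Proof.
  intros HP Hn H0 HS.
  assert (Hlt : forall m, m ∈ n -> P m).
  { intros m Hm; apply NNPP; intros Hc.
    destruct (separation (fun z => ~ P z) n) as (v & Hv); [dfn|].
    destruct (proj1 Hn) as (_ & _ & _ & _ & Hw).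
    destruct (Hw v) as (k & Hk & Hmin).
    - intros z Hz; apply Hv in Hz; tauto.
    - exists m; apply Hv; auto.
    - apply Hv in Hk as (Hk & HnP); apply HnP.
      destruct (proj2 Hn k (or_introl Hk)) as [He|(j & Hj)]; [auto|].
      assert (Hjk := is_succ_self j k Hj).
      assert (Hjn := nat_trans n k j Hn Hk Hjk).
      apply (HS j k Hjn Hj), NNPP; intros Hc'.
      apply (Hmin j); auto; apply Hv; auto. }
  destruct (proj2 Hn n (or_intror eq_refl)) as [He|(k & Hk)]; [auto|].
  pose proof (is_succ_self k n Hk); apply (HS k n); auto.
Qed.

Lemma ex_omega : exists w : M, forall n, n ∈ w <-> is_nat n.
Proof.
  destruct (zf_infinity M hM) as (w0 & (o & Ho & How) & Hsucc).
  destruct (separation is_nat w0) as (w & Hw); [dfn|].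
  exists w; intros n; rewrite Hw; split; [tauto|intros Hn; split; auto].
  apply (nat_induction (fun m => m ∈ w0) n); [dfn|exact Hn| |].
  - intros o' Ho'; rewrite (is_empty_unique o' o Ho' Ho); exact How.
  - intros k s _ Hs Hk; destruct (Hsucc k Hk) as (s' & Hs' & Hs'w).
    rewrite (is_succ_unique k s s' Hs Hs'); exact Hs'w.
Qed.

Definition alternating (h n : M) : Prop :=
  (forall o, is_empty o -> o ∈ h) /\
  (forall k s, k ∈ n -> is_succ k s -> (s ∈ h <-> ~ k ∈ h)).

Lemma ex_alternating (n : M) : is_nat n -> exists h, alternating h n.
Proof.
  intros Hn.
  apply (nat_induction (fun m => exists h, alternating h m) n);
    [unfold alternating; dfn|exact Hn| |].
  - intros o Ho; destruct (ex_succ o) as (h & Hh); exists h; split.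
    + intros o' Ho'; apply Hh; right; apply is_empty_unique; auto.
    + intros k s Hk; destruct (Ho k Hk).
  - intros k s Hkn Hs (h & Hh0 & HhS).
    assert (Hk := nat_elem n k Hn Hkn).
    assert (Hsn := nat_succ k s Hk Hs).
    destruct (ex_adjoin h s) as (u & Hu).
    (* Nothing is known about whether [h] contains [s], so membership of [s] is reset and everything
       else kept. *)
    destruct (separation (fun z => (z ∈ h /\ z <> s) \/ (z = s /\ ~ k ∈ h)) u)
      as (h' & Hh'); [dfn|].
    assert (Hin : forall z, z <> s -> (z ∈ h' <-> z ∈ h)).
    { intros z Hz; rewrite Hh', Hu; tauto. }
    assert (Hins : s ∈ h' <-> ~ k ∈ h).
    { rewrite Hh', Hu; tauto. }
    assert (Hne : forall j, j ∈ s -> j <> s).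
    { intros j Hj ->; exact (nat_irrefl s Hsn Hj). }
    exists h'; split.
    + intros o Ho; apply Hin; auto; intros ->.
      exact (Ho k (is_succ_self k s Hs)).
    + intros j s' Hj Hs'; rewrite (Hin j (Hne j Hj)).
      apply Hs in Hj as [Hj | ->].
      * rewrite Hin; [auto|]; intros ->.
        rewrite <- (is_succ_inj k j s Hk Hs Hs') in Hj.
        exact (nat_irrefl k Hk Hj).
      * rewrite (is_succ_unique k s' s Hs' Hs); exact Hins.
Qed.

(** Alternating sets agree up to [n], so one fixed [h] decides parity. This makes the negation of
    the existential statement [is_even] accessible. *)
Lemma is_even_alternating (h n : M) :
  is_nat n -> alternating h n -> (is_even n <-> n ∈ h).
Proof.
  intros Hn (H0 & HS); split.
  - intros (h' & H0' & HS' & Hn').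
    enough (Heq : n ∈ h <-> n ∈ h') by (apply Heq; exact Hn').
    apply (nat_induction (fun m => m ∈ h <-> m ∈ h') n); [dfn|exact Hn| |].
    + intros o Ho; split; auto.
    + intros k s Hk Hs IH; rewrite (HS k s Hk Hs), (HS' k s Hk Hs), IH; tauto.
  - intros Hnh; exists h; auto.
Qed.

Lemma is_even_zero (o : M) : is_empty o -> is_even o.
Proof.
  intros Ho; destruct (ex_alternating o (nat_zero o Ho)) as (h & Hh).
  apply (is_even_alternating h o (nat_zero o Ho) Hh), Hh, Ho.
Qed.

Lemma is_even_succ (n s : M) :
  is_nat n -> is_succ n s -> (is_even s <-> ~ is_even n).
Proof.
  intros Hn Hs; pose proof (nat_succ n s Hn Hs) as Hsn.
  destruct (ex_alternating s Hsn) as (h & Hh).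
  rewrite (is_even_alternating h s Hsn Hh), (is_even_alternating h n Hn).
  - apply (proj2 Hh n s (is_succ_self n s Hs) Hs).
  - split; [apply Hh|]; intros k s' Hk; apply (proj2 Hh); apply Hs; auto.
Qed.

Lemma to_move_succ (P : player) (n s : M) :
  is_nat n -> is_succ n s -> (to_move P s <-> ~ to_move P n).
Proof.
  intros Hn Hs; pose proof (is_even_succ n s Hn Hs) as H.
  destruct P; simpl; tauto.
Qed.

(** * Runs of the game *)

Lemma run_app_dom (x p n k v : M) : is_run x p n -> app p k v -> k ∈ n \/ k = n.
Proof.
  intros (_ & (d & Hd & Hf & _) & _) (r & Hr & Hrp).
  destruct (Hf r Hrp) as (k' & v' & Hk' & Hr').
  destruct (is_opair_inj _ _ _ _ _ Hr Hr') as (-> & _); apply Hd, Hk'.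
Qed.

Lemma run_app_ex (x p n k : M) :
  is_run x p n -> k ∈ n \/ k = n -> exists v, app p k v.
Proof.
  intros (_ & (d & Hd & _ & Hf) & _) Hk.
  destruct (Hf k (proj2 (Hd k) Hk)) as (v & Hv & _); exists v; exact Hv.
Qed.

Lemma run_last (x p n : M) : is_run x p n -> exists c, app p n c.
Proof. intros H; apply (run_app_ex x p n n H); auto. Qed.

Lemma run_app_unique (x p n k v v' : M) :
  is_run x p n -> app p k v -> app p k v' -> v = v'.
Proof.
  intros Hp Hv Hv'; pose proof (run_app_dom x p n k v Hp Hv) as Hk.
  destruct Hp as (_ & (d & Hd & _ & Hf) & _).
  destruct (Hf k (proj2 (Hd k) Hk)) as (c & _ & Hc).
  rewrite <- (Hc v Hv); apply Hc, Hv'.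
Qed.

Lemma run_length_unique (x p n n' : M) : is_run x p n -> is_run x p n' -> n = n'.
Proof.
  intros H H'.
  destruct (run_last x p n H) as (c & Hc).
  destruct (run_last x p n' H') as (c' & Hc').
  destruct (run_app_dom x p n n' c' H Hc') as [H1|]; auto.
  destruct (run_app_dom x p n' n c H' Hc) as [H2|]; auto.
  destruct (nat_irrefl n (proj1 H) (nat_trans n n' n (proj1 H) H1 H2)).
Qed.

Lemma app_subset (p q k v : M) : subset p q -> app p k v -> app q k v.
Proof. intros H (r & Hr & Hrp); exists r; auto. Qed.

(** Keeps all positions of a game inside [t], where the stages live. *)
Lemma run_app_mem (t x p n k v : M) :
  is_transitive t -> x ∈ t -> is_run x p n -> app p k v -> v ∈ t.
Proof.
  intros Ht Hx Hp Hv.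
  pose proof (run_app_dom x p n k v Hp Hv) as Hk.
  assert (Hkn : is_nat k).
  { destruct Hk as [Hk | ->]; [exact (nat_elem n k (proj1 Hp) Hk)|exact (proj1 Hp)]. }
  assert (Hlt : forall j, j ∈ k -> j ∈ n).
  { intros j Hj; destruct Hk as [Hk | ->]; auto.
    exact (nat_trans n k j (proj1 Hp) Hk Hj). }
  revert v Hv.
  apply (nat_induction (fun j => forall v, app p j v -> v ∈ t) k); [dfn|exact Hkn| |].
  - intros o Ho v Hv.
    rewrite (run_app_unique x p n o v x Hp Hv); auto; apply Hp, Ho.
  - intros j s Hj Hs IH v Hv.
    destruct (run_app_ex x p n j Hp (or_introl (Hlt j Hj))) as (u & Hu).
    apply (Ht u v (IH u Hu)).
    destruct Hp as (_ & _ & _ & Hstep); exact (Hstep j s u v (Hlt j Hj) Hs Hu Hv).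
Qed.

Lemma app_adjoin (p q r m z : M) :
  is_opair m z r -> (forall y, y ∈ q <-> y ∈ p \/ y = r) ->
  forall k v, app q k v <-> app p k v \/ (k = m /\ v = z).
Proof.
  intros Hr Hq k v; split.
  - intros (y & Hy & Hyq); apply Hq in Hyq as [Hyp | ->].
    + left; exists y; auto.
    + right; exact (is_opair_inj _ _ _ _ _ Hy Hr).
  - intros [(y & Hy & Hyp)|(-> & ->)]; [exists y|exists r]; split; auto;
      apply Hq; auto.
Qed.

Lemma ex_root_run (x o : M) : is_empty o -> exists p, is_run x p o.
Proof.
  intros Ho; destruct (ex_opair o x) as (r & Hr).
  destruct (ex_adjoin o r) as (p & Hp).
  assert (Happ : forall k v, app p k v <-> k = o /\ v = x).
  { intros k v; rewrite (app_adjoin o p r o x Hr Hp); split; [|auto].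
    intros [(y & _ & Hy)|]; [destruct (Ho y Hy)|auto]. }
  exists p; split; [exact (nat_zero o Ho)|split; [|split]].
  - destruct (ex_succ o) as (d & Hd); exists d; split; [exact Hd|split].
    + intros y Hy; exists o, x; split; [exact (is_succ_self o d Hd)|].
      apply Hp in Hy as [Hy | ->]; [destruct (Ho y Hy)|exact Hr].
    + intros u Hu; exists x; apply Hd in Hu as [Hu | ->]; [destruct (Ho u Hu)|].
      split; [apply Happ; auto|]; intros v Hv; apply Happ in Hv as (_ & ->); auto.
  - intros o' Ho'; apply Happ; split; auto; apply is_empty_unique; auto.
  - intros k s u v Hk; destruct (Ho k Hk).
Qed.

Lemma run_extend (x p n c z s : M) :
  is_run x p n -> app p n c -> z ∈ c -> is_succ n s ->
  exists q, is_run x q s /\ subset p q /\ app q s z.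
Proof.
  intros Hp Hc Hz Hs.
  pose proof (nat_succ n s (proj1 Hp) Hs) as Hsn.
  destruct (ex_opair s z) as (r & Hr).
  destruct (ex_adjoin p r) as (q & Hq).
  pose proof (app_adjoin p q r s z Hr Hq) as Happ.
  assert (Hps : forall v, ~ app p s v).
  { intros v Hv; destruct (run_app_dom x p n s v Hp Hv) as [H|H];
      apply (nat_irrefl s Hsn); apply Hs; auto. }
  assert (Hold : forall k v, k ∈ s -> app q k v -> app p k v).
  { intros k v Hk Hv; apply Happ in Hv as [Hv|(-> & _)]; auto.
    destruct (nat_irrefl s Hsn Hk). }
  assert (Hsub : subset p q) by (intros y Hy; apply Hq; auto).
  exists q; split; [|split; [exact Hsub|apply Happ; auto]].
  split; [exact Hsn|split; [|split]].
  - destruct (ex_succ s) as (d & Hd); exists d; split; [exact Hd|split].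
    + intros y Hy; apply Hq in Hy as [Hy | ->].
      * destruct Hp as (_ & (d' & Hd' & Hf & _) & _).
        destruct (Hf y Hy) as (u & v & Hu & Huv); exists u, v; split; auto.
        apply Hd; left; rewrite (is_succ_unique n s d' Hs Hd'); exact Hu.
      * exists s, z; split; [exact (is_succ_self s d Hd)|exact Hr].
    + intros u Hu; apply Hd in Hu as [Hu | ->].
      * destruct (run_app_ex x p n u Hp (proj1 (Hs u) Hu)) as (v & Hv).
        exists v; split; [apply Happ; auto|].
        intros v' Hv'; exact (run_app_unique x p n u v v' Hp Hv (Hold u v' Hu Hv')).
      * exists z; split; [apply Happ; auto|].
        intros v' Hv'; apply Happ in Hv' as [Hv'|(_ & ->)]; auto.
        destruct (Hps v' Hv').
  - intros o Ho; apply Happ; left; apply Hp, Ho.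
  - intros k s' u v Hk Hs' Hu Hv.
    apply (Hold k u Hk) in Hu.
    apply Hs in Hk as [Hk | ->].
    + apply Happ in Hv as [Hv|(-> & _)].
      * destruct Hp as (_ & _ & _ & Hstep); exact (Hstep k s' u v Hk Hs' Hu Hv).
      * rewrite <- (is_succ_inj n k s (proj1 Hp) Hs Hs') in Hk.
        destruct (nat_irrefl n (proj1 Hp) Hk).
    + rewrite (is_succ_unique n s' s Hs' Hs) in Hv.
      apply Happ in Hv as [Hv|(_ & ->)]; [destruct (Hps v Hv)|].
      rewrite (run_app_unique x p n n u c Hp Hu Hc); exact Hz.
Qed.

Lemma next_run_elim (x p q n : M) :
  is_run x p n -> next_run x p q ->
  exists s, is_succ n s /\ is_run x q s /\ subset p q.
Proof.
  intros Hp (n' & s & Hs & Hp' & Hq & Hsub).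
  rewrite (run_length_unique x p n n' Hp Hp'); exists s; auto.
Qed.

Lemma next_run_last (x p q n s c v : M) :
  is_run x p n -> is_run x q s -> is_succ n s -> subset p q ->
  app p n c -> app q s v -> v ∈ c.
Proof.
  intros Hp (_ & _ & _ & Hstep) Hs Hsub Hc Hv.
  apply (Hstep n s c v); auto; [exact (is_succ_self n s Hs)|].
  exact (app_subset p q n c Hsub Hc).
Qed.

Lemma next_run_app (x p q n s k v : M) :
  is_run x p n -> is_run x q s -> is_succ n s -> subset p q ->
  app q k v -> app p k v \/ k = s.
Proof.
  intros Hp Hq Hs Hsub Hv.
  destruct (run_app_dom x q s k v Hq Hv) as [Hk|]; [left|auto].
  destruct (run_app_ex x p n k Hp (proj1 (Hs k) Hk)) as (v' & Hv').
  rewrite (run_app_unique x q s k v v' Hq Hv (app_subset p q k v' Hsub Hv')).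
  exact Hv'.
Qed.

(** Kuratowski pairs over the union [u] of ω and [t] lie in its second power set, so runs lie in the
    third. Hence runs can be collected by separation. *)
Lemma runs_bounded (t x : M) :
  is_transitive t -> x ∈ t -> exists B, forall p n, is_run x p n -> p ∈ B.
Proof.
  intros Ht Hx; destruct ex_omega as (w & Hw).
  destruct (ex_union2 w t) as (u & Hu).
  destruct (zf_powerset M hM u) as (b1 & H1).
  destruct (zf_powerset M hM b1) as (b2 & H2).
  destruct (zf_powerset M hM b2) as (b3 & H3).
  exists b3; intros p n Hp; apply H3; intros r Hr.
  destruct (proj1 (proj2 Hp)) as (d & Hd & Hf & _).
  destruct (Hf r Hr) as (k & v & Hk & Hkv).
  assert (Hku : k ∈ u).
  { apply Hu; left; apply Hw; apply Hd in Hk as [Hk | ->]; [|exact (proj1 Hp)].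
    exact (nat_elem n k (proj1 Hp) Hk). }
  assert (Hvu : v ∈ u).
  { apply Hu; right; apply (run_app_mem t x p n k v Ht Hx Hp); exists r; auto. }
  destruct Hkv as (a & b & Ha & Hb & Hab).
  apply H2; intros y Hy; apply H1; intros z Hz.
  apply Hab in Hy as [-> | ->]; [apply Ha in Hz|apply Hb in Hz];
    destruct Hz as [-> | ->]; auto.
Qed.

(** * The stages of the lost positions *)

Section Stages.
Variable t : M.

(** One application covers a move and its answer, so that the same player is to move at [y] and at
    [w]. *)
Definition is_step (X Y : M) : Prop :=
  forall y, y ∈ Y <-> y ∈ t /\ forall z, z ∈ y -> exists w, w ∈ z /\ w ∈ X.

(** The case of empty [G] puts the empty set into [F], which starts the iteration. *)
Definition closed_family (F : M) : Prop :=
  (forall X Y, X ∈ F -> is_step X Y -> Y ∈ F) /\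
  (forall G U, subset G F -> is_union G U -> U ∈ F).

(* The stages of the transfinite iteration of [is_step], without ordinals. *)
Definition stage (X : M) : Prop :=
  subset X t /\ forall F, closed_family F -> X ∈ F.

(* The player to move at [y] loses. *)
Definition lost (y : M) : Prop := exists X, stage X /\ y ∈ X.

Definition won (y : M) : Prop := exists z, z ∈ y /\ lost z.

(** Comparison of ranks without ranks: [v] enters the stages strictly before [y], which may never
    enter. *)
Definition prec (v y : M) : Prop := exists X, stage X /\ v ∈ X /\ ~ y ∈ X.

Lemma definable_stage : definable (fun e => stage (e 0)).
Proof. unfold stage, closed_family, is_step; dfn. Qed.

Lemma definable_lost : definable (fun e => lost (e 0)).
Proof. pose proof definable_stage; unfold lost; dfn. Qed.

Lemma definable_won : definable (fun e => won (e 0)).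
Proof. pose proof definable_lost; unfold won; dfn. Qed.

Lemma definable_prec (a b : (nat -> M) -> M) :
  atom a -> atom b -> definable (fun e => prec (a e) (b e)).
Proof. pose proof definable_stage; unfold prec; intros; dfn. Qed.

Lemma ex_step (X : M) : exists Y, is_step X Y.
Proof.
  destruct (separation (fun y => forall z, z ∈ y -> exists w, w ∈ z /\ w ∈ X) t)
    as (Y & HY); [dfn|].
  exists Y; exact HY.
Qed.

Lemma step_mono (X X' Y Y' : M) :
  is_step X Y -> is_step X' Y' -> subset X X' -> subset Y Y'.
Proof.
  intros HY HY' H y Hy; apply HY in Hy as (Hyt & Hy); apply HY'; split; auto.
  intros z Hz; destruct (Hy z Hz) as (w & Hw & HwX); eauto.
Qed.

Lemma stage_step (X Y : M) : stage X -> is_step X Y -> stage Y.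
Proof.
  intros (_ & HX) HY; split.
  - intros y Hy; apply HY in Hy; tauto.
  - intros F HF; apply (proj1 HF X Y); auto.
Qed.

Lemma stage_union (G U : M) :
  (forall X, X ∈ G -> stage X) -> is_union G U -> stage U.
Proof.
  intros HG HU; split.
  - intros y Hy; apply HU in Hy as (X & HX & Hy).
    destruct (HG X HX) as (H & _); auto.
  - intros F HF; apply (proj2 HF G U); auto.
    intros X HX; destruct (HG X HX) as (_ & H); auto.
Qed.

(** The stages with property [Q] form a set, being subsets of [t], and this set is a closed
    family. *)
Lemma stage_ind (Q : M -> Prop) :
  definable (fun e => Q (e 0)) ->
  (forall X Y, stage X -> Q X -> is_step X Y -> Q Y) ->
  (forall G U, (forall X, X ∈ G -> stage X /\ Q X) -> is_union G U -> Q U) ->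
  forall X, stage X -> Q X.
Proof.
  intros HQ Hstep Hunion X HX; pose proof definable_stage as HD.
  destruct (zf_powerset M hM t) as (b & Hb).
  destruct (separation (fun Y => stage Y /\ Q Y) b) as (F & HF); [dfn|].
  apply (HF X), (proj2 HX); split.
  - intros Y Z HY HZ; apply HF in HY as (_ & HY & HQY).
    pose proof (stage_step Y Z HY HZ) as HsZ.
    apply HF; split; [apply Hb, HsZ|split; eauto].
  - intros G U HG HU.
    assert (HG' : forall Y, Y ∈ G -> stage Y /\ Q Y).
    { intros Y HY; apply HG, HF in HY; tauto. }
    assert (HsU : stage U).
    { apply (stage_union G U); auto; intros Y HY; apply HG'; exact HY. }
    apply HF; split; [apply Hb, HsU|split; eauto].
Qed.

Lemma stage_Union (Q : M -> Prop) :
  definable (fun e => Q (e 0)) ->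
  exists U, stage U /\ forall z, z ∈ U <-> exists X, stage X /\ Q X /\ z ∈ X.
Proof.
  intros HQ; pose proof definable_stage as HD.
  destruct (zf_powerset M hM t) as (b & Hb).
  destruct (separation (fun Y => stage Y /\ Q Y) b) as (G & HG); [dfn|].
  destruct (zf_union M hM G) as (U & HU).
  exists U; split.
  - apply (stage_union G U); auto; intros X HX; apply HG in HX; tauto.
  - intros z; rewrite (HU z); split.
    + intros (X & HX & Hz); apply HG in HX; exists X; tauto.
    + intros (X & HX & HQX & Hz); exists X; split; auto.
      apply HG; split; auto; apply Hb, HX.
Qed.

Lemma stage_inflationary (X Y : M) : stage X -> is_step X Y -> subset X Y.
Proof.
  intros HX; revert Y.
  apply (stage_ind (fun X => forall Y, is_step X Y -> subset X Y)); auto;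
    [unfold is_step; dfn| |].
  - intros A B _ IH HB C HC; apply (step_mono A B B C); auto.
  - intros G U HG HU Y HY y Hy; apply HU in Hy as (A & HA & Hy).
    destruct (ex_step A) as (B & HB); destruct (HG A HA) as (_ & IH).
    apply (step_mono A U B Y); auto.
    + intros z Hz; apply HU; eauto.
    + apply IH; auto.
Qed.

(* As in the proof of the Bourbaki-Witt theorem, linearity is proved first for
   the stages with this property, which all stages then turn out to have. *)
Definition cut_stage (X : M) : Prop :=
  forall Y Z, stage Y -> subset Y X -> Y <> X -> is_step Y Z -> subset Z X.

(** Induction on [Y]: a stage properly inside [X] steps to one still inside [X] by the cut property,
    and [X] itself steps to [X']. *)
Lemma cut_stage_compare (X X' : M) :
  stage X -> is_step X X' -> cut_stage X ->
  forall Y, stage Y -> subset Y X \/ subset X' Y.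
Proof.
  intros HX HX' Hcut.
  apply (stage_ind (fun Y => subset Y X \/ subset X' Y)); [dfn| |].
  - intros A B HA [IH|IH] HB.
    + destruct (classic (A = X)) as [-> |Hne].
      * right; apply (step_mono X X X' B); auto; intros z; auto.
      * left; apply (Hcut A B); auto.
    + right; intros z Hz; apply (stage_inflationary A B HA HB); auto.
  - intros G U HG HU.
    destruct (classic (exists A, A ∈ G /\ subset X' A)) as [(A & HA & H)|H].
    + right; intros z Hz; apply HU; eauto.
    + left; intros z Hz; apply HU in Hz as (A & HA & Hz).
      destruct (HG A HA) as (_ & [IH|IH]); auto.
      destruct H; eauto.
Qed.

Lemma all_stages_cut (X : M) : stage X -> cut_stage X.
Proof.
  apply (stage_ind cut_stage).
  - pose proof definable_stage; unfold cut_stage, is_step; dfn.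
  - intros A B HA IH HB Y Z HY Hsub Hne HZ.
    destruct (cut_stage_compare A B HA HB IH Y HY) as [H|H].
    + exact (step_mono Y A Z B HZ HB H).
    + destruct Hne; apply set_ext; intros z; split; auto.
  - intros G U HG HU Y Z HY Hsub Hne HZ.
    destruct (classic (exists A, A ∈ G /\ subset Y A)) as [(A & HA & HYA)|H].
    + destruct (HG A HA) as (HsA & HcA).
      assert (HAU : subset A U) by (intros z Hz; apply HU; eauto).
      destruct (classic (Y = A)) as [-> |HneA].
      (* The step of [A] may leave [A], so the cut property of [A] says nothing here; [U] itself is
         compared with [A]. *)
      * assert (HsU : stage U).
        { apply (stage_union G U); auto; intros B HB; apply HG, HB. }
        destruct (cut_stage_compare A Z HsA HZ HcA U HsU) as [H|H]; auto.
        destruct Hne; apply set_ext; intros z; split; auto.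
      * intros z Hz; apply HAU, (HcA Y Z); auto.
    (* As no member of [G] contains [Y], comparison puts each of them inside [Y], whence [Y = U]. *)
    + destruct Hne; apply set_ext; intros z; split; auto.
      intros Hz; apply HU in Hz as (A & HA & Hz).
      destruct (HG A HA) as (HsA & HcA); destruct (ex_step A) as (A' & HA').
      destruct (cut_stage_compare A A' HsA HA' HcA Y HY) as [H'|H'].
      * destruct H; eauto.
      * apply H', (stage_inflationary A A' HsA HA'), Hz.
Qed.

Lemma stage_compare (X X' Y : M) :
  stage X -> is_step X X' -> stage Y -> subset Y X \/ subset X' Y.
Proof. intros HX HX'; apply cut_stage_compare; auto; apply all_stages_cut, HX. Qed.

(** Replaces the least rank of an element of [Q]: [U] is the largest stage disjoint from [Q], and
    its step must meet [Q]. *)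
Lemma lost_first_stage (Q : M -> Prop) :
  definable (fun e => Q (e 0)) -> (exists y, lost y /\ Q y) ->
  exists U U', stage U /\ is_step U U' /\
    (forall z, z ∈ U -> ~ Q z) /\ exists y, y ∈ U' /\ Q y.
Proof.
  intros HQ (y & (X & HX & HyX) & HQy).
  destruct (stage_Union (fun X => forall z, z ∈ X -> ~ Q z)) as (U & HU & HUz); [dfn|].
  destruct (ex_step U) as (U' & HU').
  exists U, U'; split; [exact HU|split; [exact HU'|split]].
  - intros z Hz; apply HUz in Hz as (Y & _ & HY & Hz); auto.
  - apply NNPP; intros Hno.
    (* If [U'] missed [Q] too, it would be one of the stages united in [U]; then [U] would be closed
       under the step and contain every stage, in particular [X]. *)
    assert (Hfix : subset U' U).
    { intros z Hz; apply HUz; exists U'; split; [exact (stage_step U U' HU HU')|].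
      split; auto; intros z' Hz' HQz'; apply Hno; eauto. }
    assert (HXU : subset X U).
    { apply (stage_ind (fun X => subset X U)); [dfn| | |exact HX].
      - intros A B _ IH HB z Hz; apply Hfix, (step_mono A U B U'); auto.
      - intros G V HG HV z Hz; apply HV in Hz as (A & HA & Hz).
        apply (HG A HA), Hz. }
    apply HXU, HUz in HyX as (Y & _ & HY & Hy); exact (HY y Hy HQy).
Qed.

(** Any element of [Q] in the first stage meeting [Q] is minimal: by linearity, a stage that omits
    it is contained in [U], which avoids [Q]. *)
Lemma prec_wf (Q : M -> Prop) :
  definable (fun e => Q (e 0)) -> (exists y, lost y /\ Q y) ->
  exists y, lost y /\ Q y /\ forall y', Q y' -> ~ prec y' y.
Proof.
  intros HQ Hex.
  destruct (lost_first_stage Q HQ Hex) as (U & U' & HU & HU' & Hno & y & Hy & HQy).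
  exists y; split; [|split; [exact HQy|]].
  - exists U'; split; [exact (stage_step U U' HU HU')|exact Hy].
  - intros y' HQy' (X & HX & Hy'X & HyX).
    destruct (stage_compare U U' X HU HU' HX) as [H|H].
    + exact (Hno y' (H y' Hy'X) HQy').
    + exact (HyX (H y Hy)).
Qed.

Lemma lost_reply (y z : M) : lost y -> z ∈ y -> exists w, w ∈ z /\ prec w y.
Proof.
  intros Hy Hz.
  destruct (lost_first_stage (fun v => v = y)) as (U & U' & HU & HU' & Hno & v & Hv & ->);
    [dfn|eauto|].
  apply HU' in Hv as (_ & Hv); destruct (Hv z Hz) as (w & Hw & HwU).
  exists w; split; [exact Hw|]; exists U; split; [exact HU|split; [exact HwU|]].
  intros HyU; exact (Hno y HyU eq_refl).
Qed.

Lemma lost_won (y z : M) : lost y -> z ∈ y -> won z.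
Proof.
  intros Hy Hz; destruct (lost_reply y z Hy Hz) as (w & Hw & X & HX & HwX & _).
  exists w; split; [exact Hw|]; exists X; auto.
Qed.

(** The union [L] of all stages is itself a stage, and so is its step. *)
Lemma lost_intro (y : M) : y ∈ t -> (forall z, z ∈ y -> won z) -> lost y.
Proof.
  intros Hyt Hy.
  destruct (stage_Union (fun X => X = X)) as (L & HL & HLz); [dfn|].
  destruct (ex_step L) as (L' & HL').
  exists L'; split; [exact (stage_step L L' HL HL')|].
  apply HL'; split; [exact Hyt|].
  intros z Hz; destruct (Hy z Hz) as (w & Hw & X & HX & HwX).
  exists w; split; [exact Hw|]; apply HLz; exists X; auto.
Qed.

(* The reply [w] to [z], being [prec]-least, is below the reply that the stage
   of [y] provides. *)
Lemma least_reply_prec (y z w : M) :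
  lost y -> z ∈ y -> (forall w', w' ∈ z -> lost w' -> ~ prec w' w) -> prec w y.
Proof.
  intros Hy Hz Hmin.
  destruct (lost_reply y z Hy Hz) as (w' & Hw' & X & HX & Hw'X & HyX).
  exists X; split; [exact HX|split; [|exact HyX]].
  apply NNPP; intros Hn; apply (Hmin w' Hw'); [exists X; auto|].
  exists X; auto.
Qed.

(** * Winning strategies and lost positions *)

Hypothesis t_transitive : is_transitive t.

Lemma winning_lost_or_won (x : M) : x ∈ t -> winning x -> lost x \/ won x.
Proof.
  intros Hx (P & T & (Hruns & (p0 & o & Ho & Hp0 & Hp0T) & _ & Hopp & Hown) &
             Hstuck & Hwf).
  pose proof definable_lost as Dl; pose proof definable_won as Dw.
  (* The invariant along [T] depends on whose turn it is. Its counterexamples form a subset of [T],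
     so well-foundedness provides one without a bad successor. *)
  assert (Hall : forall p n c, p ∈ T -> is_run x p n -> app p n c ->
                   (to_move P n -> won c) /\ (~ to_move P n -> lost c)).
  { apply NNPP; intros Hbad.
    destruct (separation (fun p => exists n c, is_run x p n /\ app p n c /\
       ~ ((to_move P n -> won c) /\ (~ to_move P n -> lost c))) T)
      as (b & Hb); [dfn|].
    destruct (Hwf b) as (p & Hp & Hmin).
    - intros p Hp; apply Hb in Hp; tauto.
    - apply NNPP; intros Hne; apply Hbad; intros p n c Hp Hrun Hc.
      apply NNPP; intros Hcon; apply Hne; exists p; apply Hb; split; eauto.
    - apply Hb in Hp as (HpT & n & c & Hrun & Hc & Hcon); apply Hcon.
      destruct (ex_succ n) as (s & Hs).
      pose proof (to_move_succ P n s (proj1 Hrun) Hs) as Hturn.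
      assert (Hnext : forall q v, q ∈ T -> next_run x p q -> app q s v ->
                 (to_move P s -> won v) /\ (~ to_move P s -> lost v)).
      { intros q v HqT Hpq Hv; apply NNPP; intros Hcon'.
        destruct (next_run_elim x p q n Hrun Hpq) as (s' & Hs' & Hq & _).
        rewrite <- (is_succ_unique n s s' Hs Hs') in Hq.
        apply (Hmin q); auto; apply Hb; split; eauto. }
      split; intros Hmove.
      + assert (Hne : exists z, z ∈ c).
        { apply NNPP; intros He; apply (Hstuck p n c); auto.
          intros z Hz; eauto. }
        destruct Hne as (z & Hz).
        (* The move to [z] only shows that [P] is not stuck; the move retained by the strategy is
           the last entry [v] of [q]. *)
        destruct (run_extend x p n c z s Hrun Hc Hz Hs) as (q0 & Hq0 & Hsub0 & _).
        destruct (Hown p n HpT Hrun Hmove) as (q & Hpq & HqT).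
        { exists q0, n, s; auto. }
        destruct (next_run_elim x p q n Hrun Hpq) as (s' & Hs' & Hq & Hsub).
        rewrite <- (is_succ_unique n s s' Hs Hs') in Hq.
        destruct (run_last x q s Hq) as (v & Hv).
        exists v; split; [exact (next_run_last x p q n s c v Hrun Hq Hs Hsub Hc Hv)|].
        apply (Hnext q v); tauto.
      + apply lost_intro; [exact (run_app_mem t x p n n c t_transitive Hx Hrun Hc)|].
        intros z Hz.
        destruct (run_extend x p n c z s Hrun Hc Hz Hs) as (q & Hq & Hsub & Hqz).
        assert (Hpq : next_run x p q) by (exists n, s; auto).
        apply (Hnext q z); [apply (Hopp p n); auto|exact Hpq|exact Hqz|tauto]. }
  assert (Hp0x : app p0 o x) by (apply Hp0; exact Ho).
  destruct (Hall p0 o x Hp0T Hp0 Hp0x) as (H1 & H2).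
  destruct (classic (to_move P o)); auto.
Qed.

(** The plays in which [P] always moves to a [prec]-minimal lost element. The conditions speak of
    the whole history, which makes the tree of good runs closed under initial segments. *)
Definition good_run (x : M) (P : player) (p : M) : Prop :=
  (exists n, is_run x p n) /\
  (forall k v, app p k v -> (to_move P k -> won v) /\ (~ to_move P k -> lost v)) /\
  (forall k s u v, is_succ k s -> to_move P k -> app p k u -> app p s v ->
     forall w, w ∈ u -> lost w -> ~ prec w v).

Lemma definable_good_run (x : M) (P : player) :
  definable (fun e => good_run x P (e 0)).
Proof.
  pose proof definable_lost; pose proof definable_won; pose proof definable_prec.
  unfold good_run; dfn.
Qed.

(** Only moves of [P] carry a condition: on the adversary's turn [c] is lost, so whatever element is
    chosen is won. *)
Lemma good_run_extend (x : M) (P : player) (p q n s c v : M) :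
  good_run x P p -> is_run x p n -> is_run x q s -> is_succ n s -> subset p q ->
  app p n c -> app q s v ->
  (to_move P n -> lost v /\ forall w, w ∈ c -> lost w -> ~ prec w v) ->
  good_run x P q.
Proof.
  intros (_ & Hval & Hmin) Hp Hq Hs Hsub Hc Hv Hmove.
  pose proof (to_move_succ P n s (proj1 Hp) Hs) as Hturn.
  pose proof (nat_irrefl s (proj1 Hq)) as Hirr.
  split; [eauto|split].
  - intros k u Hu.
    destruct (next_run_app x p q n s k u Hp Hq Hs Hsub Hu) as [Hu' | ->]; [eauto|].
    rewrite (run_app_unique x q s s u v Hq Hu Hv).
    split; intros H; [|tauto].
    apply (lost_won c); [apply (Hval n c Hc); tauto|].
    exact (next_run_last x p q n s c v Hp Hq Hs Hsub Hc Hv).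
  - intros k s' u y Hs' Hk Hu Hy.
    destruct (next_run_app x p q n s k u Hp Hq Hs Hsub Hu) as [Hu' | ->].
    + destruct (next_run_app x p q n s s' y Hp Hq Hs Hsub Hy) as [Hy' | ->];
        [eauto|].
      rewrite <- (is_succ_inj n k s (proj1 Hp) Hs Hs') in *.
      rewrite (run_app_unique x q s s y v Hq Hy Hv).
      rewrite (run_app_unique x p n n u c Hp Hu' Hc); tauto.
    (* [s] is the last index of [q], so there is no entry at its successor. *)
    + pose proof (is_succ_self s s' Hs') as Hss'.
      destruct (run_app_dom x q s s' y Hq Hy) as [H | ->]; [|contradiction].
      destruct (Hirr (nat_trans s s' s (proj1 Hq) H Hss')).
Qed.

(** If every run in [s] had a successor in [s], take a [prec]-minimal position at which the
    adversary is to move. Two moves later comes another such position, [prec]-below it by the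
    minimality of the reply of [P]. *)
Lemma good_runs_wf (x : M) (P : player) (s : M) :
  (forall p, p ∈ s -> good_run x P p) -> (exists p, p ∈ s) ->
  exists p, p ∈ s /\ forall q, q ∈ s -> ~ next_run x p q.
Proof.
  intros Hgood (p0 & Hp0); apply NNPP; intros Hno.
  assert (Hnext : forall p n, p ∈ s -> is_run x p n ->
            exists q m, q ∈ s /\ is_succ n m /\ is_run x q m /\ subset p q).
  { intros p n Hp Hrun; apply NNPP; intros Hc; apply Hno; exists p; split; auto.
    intros q Hq Hpq; destruct (next_run_elim x p q n Hrun Hpq) as (m & H).
    apply Hc; exists q, m; auto. }
  set (Q y := exists p n, p ∈ s /\ is_run x p n /\ ~ to_move P n /\ app p n y).
  assert (HQ : forall p n, p ∈ s -> is_run x p n -> ~ to_move P n ->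
                 exists y, lost y /\ Q y).
  { intros p n Hp Hrun Hmove; destruct (run_last x p n Hrun) as (y & Hy).
    exists y; split; [|exists p, n; auto].
    apply (proj1 (proj2 (Hgood p Hp)) n y Hy), Hmove. }
  destruct (prec_wf Q) as (y & Hly & (p & n & Hp & Hrun & Hmove & Hy) & Hmin).
  - unfold Q; dfn.
  - destruct (proj1 (Hgood p0 Hp0)) as (n & Hn).
    destruct (classic (to_move P n)) as [Hm|Hm]; [|exact (HQ p0 n Hp0 Hn Hm)].
    destruct (Hnext p0 n Hp0 Hn) as (q & m & Hq & Hsm & Hqm & _).
    apply (HQ q m Hq Hqm); rewrite (to_move_succ P n m (proj1 Hn) Hsm); tauto.
  - destruct (Hnext p n Hp Hrun) as (q & m & Hq & Hsm & Hqm & Hpq).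
    destruct (Hnext q m Hq Hqm) as (r & l & Hr & Hsl & Hrl & Hqr).
    destruct (run_last x q m Hqm) as (z & Hz).
    destruct (run_last x r l Hrl) as (w & Hw).
    pose proof (to_move_succ P n m (proj1 Hrun) Hsm) as Hm.
    pose proof (to_move_succ P m l (proj1 Hqm) Hsl) as Hl.
    apply (Hmin w).
    + exists r, l; tauto.
    + apply (least_reply_prec y z w Hly).
      * exact (next_run_last x p q n m y z Hrun Hqm Hsm Hpq Hy Hz).
      * apply (proj2 (proj2 (Hgood r Hr)) m l z w Hsl); [tauto| |exact Hw].
        exact (app_subset q r m z Hqr Hz).
Qed.

Lemma good_runs_strategy (x : M) (P : player) :
  x ∈ t ->
  (forall o : M, is_empty o -> (to_move P o -> won x) /\ (~ to_move P o -> lost x)) ->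
  winning x.
Proof.
  intros Hx Hroot.
  pose proof (definable_good_run x P) as Dg.
  destruct (runs_bounded t x t_transitive Hx) as (B & HB).
  (* The tree consists of all good runs; ties between minimal replies are left unresolved. *)
  destruct (separation (good_run x P) B) as (T & HT0); [dfn|].
  assert (HT : forall p, p ∈ T <-> good_run x P p).
  { intros p; rewrite HT0; split; [tauto|intros Hp; split; auto].
    destruct (proj1 Hp) as (n & Hn); eauto. }
  exists P, T; split; [|split].
  - split; [|split; [|split; [|split]]].
    + intros p Hp; apply HT in Hp; apply Hp.
    + destruct ex_empty as (o & Ho); destruct (ex_root_run x o Ho) as (p & Hp).
      assert (Hpx : app p o x) by (apply Hp; exact Ho).
      assert (Hdom : forall k v, app p k v -> k = o).
      { intros k v Hv; destruct (run_app_dom x p o k v Hp Hv) as [H|]; auto.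
        destruct (Ho k H). }
      exists p, o; split; [exact Ho|split; [exact Hp|]]; apply HT.
      split; [eauto|split].
      * intros k v Hv; pose proof (Hdom k v Hv); subst k.
        rewrite (run_app_unique x p o o v x Hp Hv Hpx); auto.
      * intros k s u v Hs _ _ Hv; rewrite (Hdom s v Hv) in Hs.
        destruct (Ho k (is_succ_self k o Hs)).
    + intros p q Hq (n & s & Hs & Hp & _ & Hsub); apply HT in Hq; apply HT.
      destruct Hq as (_ & Hval & Hmin); pose proof (app_subset p q) as Hpq.
      split; [eauto|split].
      * intros k v Hv; apply Hval; auto.
      * intros k s' u v Hs' Hk Hu Hv; apply (Hmin k s' u v); auto.
    + intros p n Hp Hrun Hmove q Hpq; apply HT in Hp; apply HT.
      destruct (next_run_elim x p q n Hrun Hpq) as (s & Hs & Hq & Hsub).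
      destruct (run_last x p n Hrun) as (c & Hc).
      destruct (run_last x q s Hq) as (v & Hv).
      apply (good_run_extend x P p q n s c v); tauto.
    + intros p n Hp Hrun Hmove _; apply HT in Hp.
      destruct (run_last x p n Hrun) as (c & Hc).
      destruct (proj1 (proj1 (proj2 Hp) n c Hc) Hmove) as (z & Hz & Hlz).
      destruct (prec_wf (fun w => w ∈ c)) as (w & Hlw & Hw & Hmin); [dfn|eauto|].
      destruct (ex_succ n) as (s & Hs).
      destruct (run_extend x p n c w s Hrun Hc Hw Hs) as (q & Hq & Hsub & Hqw).
      exists q; split; [exists n, s; auto|]; apply HT.
      apply (good_run_extend x P p q n s c w); auto.
  - intros p n c Hp Hrun Hc He Hmove; apply HT in Hp.
    destruct (proj1 (proj1 (proj2 Hp) n c Hc) Hmove) as (z & Hz & _).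
    exact (He z Hz).
  - intros s Hs; apply (good_runs_wf x P); intros p Hp; apply HT, Hs, Hp.
Qed.

(** Length 0 is even, so player I moves first: player II wins from a lost set and player I from a
    won one. *)
Lemma winning_iff (x : M) : x ∈ t -> (winning x <-> lost x \/ won x).
Proof.
  intros Hx; split; [exact (winning_lost_or_won x Hx)|].
  intros [H|H].
  - apply (good_runs_strategy x player_II Hx); intros o Ho; simpl.
    pose proof (is_even_zero o Ho); tauto.
  - apply (good_runs_strategy x player_I Hx); intros o Ho; simpl.
    pose proof (is_even_zero o Ho); tauto.
Qed.

Lemma winning_of_elements (x : M) :
  x ∈ t -> (forall z, z ∈ x -> winning z) -> winning x.
Proof.
  intros Hx Hel; apply (winning_iff x Hx).
  destruct (classic (won x)) as [|Hnw]; [auto|left].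
  apply lost_intro; [exact Hx|]; intros z Hz.
  destruct (proj1 (winning_iff z (t_transitive x z Hx Hz)) (Hel z Hz)) as [H|H]; auto.
  destruct Hnw; exists z; auto.
Qed.

End Stages.

(** * Hereditarily winning sets *)

Lemma is_tc_unique (x a b : M) : is_tc x a -> is_tc x b -> a = b.
Proof.
  intros (Ha & Hxa & Hmina) (Hb & Hxb & Hminb).
  apply set_ext; intros z; split; [apply Hmina|apply Hminb]; auto.
Qed.

(** Given some transitive [t] containing [x], the transitive closure is cut out of [t] as the
    intersection of all such sets, without recursion. *)
Lemma HW_iff (x : M) :
  HW x <-> exists t, is_transitive t /\ x ∈ t /\ forall z, z ∈ t -> winning z.
Proof.
  split.
  - intros (s & t & Hs & (Ht & Hst & _) & Hwin).
    exists t; split; [exact Ht|split; [|exact Hwin]]; apply Hst, Hs; auto.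
  - intros (t & Ht & Hx & Hwin).
    destruct (zf_pairing M hM x x) as (s & Hs).
    assert (Hsx : forall u, subset s u <-> x ∈ u).
    { intros u; split; intros H; [apply H, Hs; auto|].
      intros z Hz; apply Hs in Hz as [-> | ->]; exact H. }
    destruct (separation (fun z => forall u, is_transitive u -> subset s u -> z ∈ u) t)
      as (t' & Ht'); [dfn|].
    exists s, t'; split; [exact Hs|split; [split; [|split]|]].
    + intros y z Hy Hz; apply Ht' in Hy as (Hyt & Hy); apply Ht'.
      split; [exact (Ht y z Hyt Hz)|]; intros u Hu Hsu.
      exact (Hu y z (Hy u Hu Hsu) Hz).
    + apply Hsx, Ht'; split; [exact Hx|]; intros u _ Hu.
      exact (proj1 (Hsx u) Hu).
    + intros u Hu Hsu z Hz; apply Ht' in Hz as (_ & Hz); auto.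
    + intros z Hz; apply Ht' in Hz as (Hz & _); auto.
Qed.

Lemma HW_transitive (x y : M) : HW x -> y ∈ x -> HW y.
Proof.
  intros Hx Hy; apply HW_iff in Hx as (t & Ht & Hxt & Hwin).
  apply HW_iff; exists t; split; [exact Ht|split; [exact (Ht x y Hxt Hy)|exact Hwin]].
Qed.

(** Transitive closures are unique, so Replacement collects those of the elements with neither
    Choice nor Collection. *)
Lemma HW_of_elements (x : M) : (forall z, z ∈ x -> HW z) -> HW x.
Proof.
  intros Hel.
  destruct (replacement (fun z t => exists s, is_pair z z s /\ is_tc s t) x)
    as (F & HF); [dfn| |].
  { intros u v v' _ (s & Hs & Hv) (s' & Hs' & Hv').
    rewrite (is_pair_unique u u s' s Hs' Hs) in Hv'; exact (is_tc_unique s v v' Hv Hv'). }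
  destruct (zf_union M hM F) as (U & HU).
  assert (HUt : is_transitive U).
  { intros y z Hy Hz; apply HU in Hy as (t & Ht & Hy); apply HU.
    exists t; split; [exact Ht|].
    apply HF in Ht as (_ & _ & s & _ & Ht & _); exact (Ht y z Hy Hz). }
  assert (HxU : forall z, z ∈ x -> z ∈ U).
  { intros z Hz; destruct (Hel z Hz) as (s & t & Hs & Ht & _); apply HU; exists t.
    split; [apply HF; eauto|].
    apply (proj1 (proj2 Ht)), Hs; auto. }
  assert (HUw : forall z, z ∈ U -> winning z).
  { intros z Hz; apply HU in Hz as (t & Ht & Hz).
    apply HF in Ht as (y & Hy & s & Hs & Ht).
    destruct (Hel y Hy) as (s' & t' & Hs' & Ht' & Hwin).
    rewrite (is_pair_unique y y s' s Hs' Hs) in Ht'.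
    apply Hwin; rewrite (is_tc_unique s t' t Ht' Ht); exact Hz. }
  (* As [x] is a subset of [U], adjoining it keeps transitivity, and it is the only element not yet
     known to be winning. *)
  destruct (ex_adjoin U x) as (t & Ht).
  assert (Htt : is_transitive t).
  { intros y z Hy Hz; apply Ht in Hy as [Hy | ->]; apply Ht; left; eauto. }
  apply HW_iff; exists t; split; [exact Htt|split; [apply Ht; auto|]].
  intros z Hz; apply Ht in Hz as [Hz | ->]; [auto|].
  apply (winning_of_elements t Htt); [apply Ht; auto|auto].
Qed.

(** * Ordinals and well-founded sets *)

Lemma ordinal_induction (P : M -> Prop) (a : M) :
  definable (fun e => P (e 0)) -> is_ordinal a ->
  (forall b, b ∈ a -> (forall c, c ∈ b -> P c) -> P b) ->
  forall b, b ∈ a -> P b.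
Proof.
  intros HP (Ht & _ & _ & _ & Hw) Hind b Hb; apply NNPP; intros Hc.
  destruct (separation (fun z => ~ P z) a) as (s & Hs); [dfn|].
  destruct (Hw s) as (m & Hm & Hmin).
  - intros z Hz; apply Hs in Hz; tauto.
  - exists b; apply Hs; auto.
  - apply Hs in Hm as (Hma & Hm); apply Hm, Hind; [exact Hma|].
    intros c Hcm; apply NNPP; intros HnP; apply (Hmin c); [|exact Hcm].
    apply Hs; split; [exact (Ht m c Hma Hcm)|exact HnP].
Qed.

Lemma ordinal_HW (a : M) : is_ordinal a -> HW a.
Proof.
  intros Ha; apply HW_of_elements; pose proof (definable_HW M) as D.
  apply (ordinal_induction HW a); [dfn|exact Ha|].
  intros b _; apply HW_of_elements.
Qed.

(** The induction runs through the domain of one fixed hierarchy [f], so the smaller levels are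
    values of the same [f]. *)
Lemma V_infty_HW (x : M) : V_infty x -> HW x.
Proof.
  intros (a & v & _ & (f & d & (Hd & Hf & Hrec) & Ha & Hv) & Hx).
  revert v Hv x Hx; pose proof (definable_HW M) as D.
  assert (Hsub : forall b c, b ∈ d -> c ∈ b -> c ∈ d) by (apply Hd).
  apply (ordinal_induction (fun a => forall v, app f a v -> forall x, x ∈ v -> HW x) d);
    [dfn|exact Hd| |exact Ha].
  intros b Hb IH v Hv x Hx.
  destruct (Hrec b v Hb Hv) as (H0 & HS & HL).
  destruct (classic (is_empty b)) as [He|Hne]; [destruct (H0 He x Hx)|].
  destruct (classic (exists c, is_succ c b)) as [(c & Hc)|Hns].
  - pose proof (is_succ_self c b Hc) as Hcb.
    destruct (proj2 Hf c (Hsub b c Hb Hcb)) as (u & Hu & _).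
    apply HW_of_elements; intros z Hz.
    apply (IH c Hcb u Hu z), (proj1 (HS c u Hc Hu x) Hx), Hz.
  - assert (Hlim : is_limit b)
      by (split; [exact (ordinal_elem d b Hd Hb)|split; assumption]).
    destruct (proj1 (HL Hlim x) Hx) as (c & u & Hc & Hu & Hxu).
    exact (IH c Hc u Hu x Hxu).
Qed.

(** * The axioms relativized to [HW] *)

Fixpoint rel_sat (e : nat -> M) (p : formula) : Prop :=
  match p with
  | fmem i j => e i ∈ e j
  | feq i j => e i = e j
  | fbot => False
  | fimp q r => rel_sat e q -> rel_sat e r
  | fall q => forall x, HW x -> rel_sat (scons x e) q
  end.

Lemma sig_eq_iff (C : M -> Prop) (x y : {x : M | C x}) :
  x = y <-> proj1_sig x = proj1_sig y.
Proof.
  split; [intros ->; reflexivity|].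
  destruct x as [x Hx], y as [y Hy]; simpl; intros <-.
  f_equal; apply proof_irrelevance.
Qed.

Lemma rel_sat_ext (p : formula) :
  forall e e', (forall n, e n = e' n) -> (rel_sat e p <-> rel_sat e' p).
Proof.
  induction p as [i j|i j| |p IHp q IHq|p IHp]; simpl; intros e e' H.
  - rewrite !H; tauto.
  - rewrite !H; tauto.
  - tauto.
  - rewrite (IHp e e' H), (IHq e e' H); tauto.
  - assert (Hx : forall x n, scons x e n = scons x e' n)
      by (intros x [|n]; simpl; auto).
    split; intros Ha x HHx; apply (IHp _ _ (Hx x)); apply Ha, HHx.
Qed.

(** Turns truth in the subtype into a condition on elements of [M], to which the schemata of [M]
    apply. *)
Lemma sat_restrict (p : formula) :
  forall e : nat -> restrict M HW,
    sat (restrict M HW) e p <-> rel_sat (fun n => proj1_sig (e n)) p.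
Proof.
  induction p as [i j|i j| |p IHp q IHq|p IHp]; simpl; intros e.
  - tauto.
  - apply sig_eq_iff.
  - tauto.
  - rewrite IHp, IHq; tauto.
  - assert (Hx : forall x : restrict M HW, sat (restrict M HW) (scons x e) p <->
              rel_sat (scons (proj1_sig x) (fun n => proj1_sig (e n))) p).
    { intros x; rewrite IHp; apply rel_sat_ext; intros [|n]; reflexivity. }
    split.
    + intros H x Hw; apply (Hx (exist _ x Hw)), H.
    + intros H x; apply Hx, H, (proj2_sig x).
Qed.

(** Stated for any family [g] of atoms, because passing under a quantifier changes the environment
    into another such family. *)
Lemma definable_rel_sat (p : formula) :
  forall g : nat -> (nat -> M) -> M, (forall n, atom (g n)) ->
    definable (fun e => rel_sat (fun n => g n e) p).
Proof.
  induction p as [i j|i j| |p IHp q IHq|p IHp]; simpl; intros g Hg.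
  - apply definable_mem; auto.
  - apply definable_eq; auto.
  - apply definable_False.
  - apply definable_imp; auto.
  - apply definable_all, definable_imp; [apply definable_HW|].
    apply (definable_equiv M (fun e => rel_sat (fun n =>
      match n with O => e 0 | S k => g k (fun n => e (S n)) end) p)).
    + intros e; apply rel_sat_ext; intros [|n]; reflexivity.
    + apply (IHp (fun n e =>
        match n with O => e 0 | S k => g k (fun n => e (S n)) end)).
      intros [|n]; [apply atom_var|].
      apply (atom_comp M (g n) S); auto.
Qed.

Lemma restrict_ext (x y : restrict M HW) :
  (forall z, z ∈ x <-> z ∈ y) -> x = y.
Proof.
  intros H; apply sig_eq_iff, set_ext; intros z; split; intros Hz.
  - exact (proj1 (H (exist _ z (HW_transitive _ _ (proj2_sig x) Hz))) Hz).
  - exact (proj2 (H (exist _ z (HW_transitive _ _ (proj2_sig y) Hz))) Hz).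
Qed.

(** The common core of the existence axioms: by [HW_of_elements], a set of [M] with the right
    elements already belongs to the inner model. *)
Lemma ex_restrict (y : M) (Q : restrict M HW -> Prop) :
  (forall z, z ∈ y -> exists Hz : HW z, Q (exist _ z Hz)) ->
  (forall z, Q z -> proj1_sig z ∈ y) ->
  exists y' : restrict M HW, forall z, z ∈ y' <-> Q z.
Proof.
  intros H1 H2.
  assert (Hy : HW y)
    by (apply HW_of_elements; intros z Hz; destruct (H1 z Hz); assumption).
  exists (exist _ y Hy); intros z; split; [|apply H2].
  intros Hz; destruct (H1 _ Hz) as (Hw & HQ).
  replace z with (exist HW (proj1_sig z) Hw); [exact HQ|].
  apply sig_eq_iff; reflexivity.
Qed.

Lemma restrict_HW_ZFminus : ZFminus (restrict M HW).
Proof.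
  split.
  - exact restrict_ext.
  - intros [a Ha] [b Hb]; destruct (zf_pairing M hM a b) as (p & Hp).
    apply (ex_restrict p).
    + intros z Hz; apply Hp in Hz as [-> | ->];
        [exists Ha; left|exists Hb; right]; reflexivity.
    + intros z [-> | ->]; apply Hp; auto.
  - intros [x Hx]; destruct (zf_union M hM x) as (u & Hu).
    apply (ex_restrict u).
    + intros z Hz; apply Hu in Hz as (y & Hy & Hz).
      pose proof (HW_transitive x y Hx Hy) as Hwy.
      exists (HW_transitive y z Hwy Hz), (exist _ y Hwy); auto.
    + intros z (y & Hy & Hz); apply Hu; exists (proj1_sig y); auto.
  - intros [x Hx]; destruct (zf_powerset M hM x) as (p & Hp).
    apply (ex_restrict p).
    + intros z Hz; apply Hp in Hz.
      assert (Hwz : HW z)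
        by (apply HW_of_elements; intros y Hy; apply (HW_transitive x y Hx), Hz, Hy).
      exists Hwz; intros y Hy; apply Hz, Hy.
    + intros [z Hwz] Hz; apply Hp; intros y Hy.
      exact (Hz (exist _ y (HW_transitive z y Hwz Hy)) Hy).
  - destruct (zf_infinity M hM) as (w0 & (o & Ho & How) & Hsucc).
    pose proof (definable_HW M) as D.
    (* The inductive set may have elements outside [HW]; those inside are still closed under
       successor. *)
    destruct (separation HW w0) as (w & Hw); [dfn|].
    assert (Hww : HW w) by (apply HW_of_elements; intros z Hz; apply Hw in Hz; tauto).
    exists (exist _ w Hww); split.
    + assert (Hwo : HW o)
        by (apply HW_of_elements; intros z Hz; destruct (Ho z Hz)).
      exists (exist _ o Hwo); split; [intros z; apply Ho|].
      apply Hw; auto.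
    + intros [x Hx] Hxw; simpl in Hxw; apply Hw in Hxw as (Hxw & _).
      destruct (Hsucc x Hxw) as (s & Hs & Hsw).
      assert (Hws : HW s).
      { apply HW_of_elements; intros z Hz; apply Hs in Hz as [Hz | ->]; auto.
        exact (HW_transitive x z Hx Hz). }
      exists (exist _ s Hws); split; [|apply Hw; auto].
      intros z; split.
      * intros Hz; apply Hs in Hz as [Hz|Hz]; [left; exact Hz|right].
        apply sig_eq_iff; exact Hz.
      * intros [Hz | ->]; apply Hs; [left; exact Hz|right; reflexivity].
  - intros p e [x Hx].
    set (Q z := rel_sat (scons z (fun n => proj1_sig (e n))) p).
    assert (HQ : forall z : restrict M HW,
              sat (restrict M HW) (scons z e) p <-> Q (proj1_sig z)).
    { intros z; unfold Q; rewrite sat_restrict; apply rel_sat_ext.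
      intros [|n]; reflexivity. }
    destruct (separation Q x) as (y & Hy).
    { unfold Q; apply (definable_rel_sat p (fun n e' =>
        scons (e' 0) (fun n => proj1_sig (e n)) n)).
      intros [|n]; simpl; [apply atom_var|apply atom_const]. }
    apply (ex_restrict y).
    + intros z Hz; apply Hy in Hz as (Hz & HQz).
      exists (HW_transitive x z Hx Hz); split; [exact Hz|apply HQ; exact HQz].
    + intros z (Hz & HQz); apply Hy; split; [exact Hz|apply HQ; exact HQz].
  - intros p e [x Hx] Hfun.
    (* Restricting both arguments to [HW] matters: functionality is known only inside the inner
       model. *)
    set (R u v := HW u /\ HW v /\
           rel_sat (scons v (scons u (fun n => proj1_sig (e n)))) p).
    assert (HR : forall u v : restrict M HW,
      sat (restrict M HW) (scons v (scons u e)) p <-> R (proj1_sig u) (proj1_sig v)).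
    { intros u v; unfold R; rewrite sat_restrict.
      rewrite (rel_sat_ext p (fun n => proj1_sig (scons v (scons u e) n))
        (scons (proj1_sig v) (scons (proj1_sig u) (fun n => proj1_sig (e n)))))
        by (intros [|[|n]]; reflexivity).
      pose proof (proj2_sig u); pose proof (proj2_sig v); simpl in *; tauto. }
    destruct (replacement R x) as (y & Hy).
    { pose proof (definable_HW M) as D; unfold R.
      apply definable_and; [dfn|apply definable_and; [dfn|]].
      apply (definable_rel_sat p (fun n e' =>
        scons (e' 0) (scons (e' 1) (fun n => proj1_sig (e n))) n)).
      intros [|[|n]]; simpl; [apply atom_var|apply atom_var|apply atom_const]. }
    { intros u v v' Hu HRv HRv'; pose proof HRv as (Hwu & Hwv & _).
      pose proof HRv' as (_ & Hwv' & _).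
      apply (sig_eq_iff HW (exist _ v Hwv) (exist _ v' Hwv')).
      apply (Hfun (exist _ u Hwu)); [exact Hu|apply HR; exact HRv|apply HR; exact HRv']. }
    apply (ex_restrict y).
    + intros v Hv; apply Hy in Hv as (u & Hu & HRv).
      pose proof HRv as (Hwu & Hwv & _).
      exists Hwv, (exist _ u Hwu); split; [exact Hu|apply HR; exact HRv].
    + intros v (u & Hu & Huv); apply Hy; exists (proj1_sig u).
      split; [exact Hu|apply HR; exact Huv].
Qed.

End SetTheory.

Theorem theorem1 (M : set_structure) (hM : ZFminus M) :
  inner_model M HW /\ (forall x : M, V_infty x -> HW x).
Proof.
  split; [|exact (V_infty_HW M hM)].
  destruct (ex_empty M hM) as (c0 & _).
  split; [exact (definable_class M c0 HW (definable_HW M))|].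
  split; [exact (HW_transitive M hM)|].
  split; [exact (ordinal_HW M hM)|exact (restrict_HW_ZFminus M hM)].
Qed.
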